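(* The only integral means of the first kind that are homogeneous are the Stolarsky means. That is, an integral mean of the first kind $M$ is homogeneous if and only if $M=S_p$ for some $p\in\mathbb{R}$.
   Context: A mean is a function $M:(0,+\infty)^2\to(0,+\infty)$ of class $C^\infty$ such that $\min(x,y)\le M(x,y)\le\max(x,y)$ and $M(x,y)=M(y,x)$ for all $x,y>0$. A mean $M$ is an integral mean of the first kind if there is a strictly monotonic and infinitely differentiable function $f:(0,+\infty)\to\mathbb{R}$ such that $M(x,y)=f^{-1}\left(\frac{1}{y-x}\int_x^y f(t)\,dt\right)$ for all $x,y>0$ with $x\ne y$. A mean $M$ is homogeneous if $M(\lambda x,\lambda y)=\lambda M(x,y)$ for all $\lambda,x,y>0$. The Stolarsky means $S_p$ ($p\in\mathbb{R}$) are defined by $S_p(x,x)=x$ and, for $x\ne y$: $S_p(x,y)=\left(\frac{x^p-y^p}{p(x-y)}\right)^{\frac{1}{p-1}}$ if $p\notin\{0,1\}$; $S_0(x,y)=\frac{x-y}{\log x-\log y}$ (logarithmic mean); $S_1(x,y)=e^{-1}\left(\frac{x^x}{y^y}\right)^{\frac{1}{x-y}}$ (identric mean). *)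

(* Defs.v *)
From Stdlib Require Import Reals.
From Coquelicot Require Import Coquelicot.
Open Scope R_scope.

(* Functions on (0,+oo) and (0,+oo)^2 are represented by total functions on R
   and R * R; every property below only constrains them at positive arguments. *)

Definition smooth_pos (f : R -> R) : Prop :=
  forall (n : nat) (x : R), 0 < x -> ex_derive_n f n x.

(* [ex_diff_n M n x y]: all iterated partial derivatives of [M] of order at most
   [n] exist and are continuous in both variables at (x, y). *)
Definition smooth_pos2 (M : R -> R -> R) : Prop :=
  forall (n : nat) (x y : R), 0 < x -> 0 < y -> ex_diff_n M n x y.

Record is_mean (M : R -> R -> R) : Prop := {
  mean_pos : forall x y : R, 0 < x -> 0 < y -> 0 < M x y;
  mean_smooth : smooth_pos2 M;
  mean_bounds : forall x y : R, 0 < x -> 0 < y ->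
    Rmin x y <= M x y <= Rmax x y;
  mean_sym : forall x y : R, 0 < x -> 0 < y -> M x y = M y x
}.

Definition strictly_monotonic_pos (f : R -> R) : Prop :=
  (forall x y : R, 0 < x -> x < y -> f x < f y) \/
  (forall x y : R, 0 < x -> x < y -> f y < f x).

(* [finv] is the inverse of [f : (0,+oo) -> f((0,+oo))]; its values outside the
   image of (0,+oo) are irrelevant. *)
Definition inverse_pos (f finv : R -> R) : Prop :=
  forall t : R, 0 < t -> finv (f t) = t.

(* For continuous [f], the average of [f] between x and y lies in the image of
   (0,+oo), so [finv] is only applied where it is determined by [f]. *)
Definition integral_mean_first_kind (M : R -> R -> R) : Prop :=
  is_mean M /\
  exists f finv : R -> R,
    smooth_pos f /\ strictly_monotonic_pos f /\ inverse_pos f finv /\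
    forall x y : R, 0 < x -> 0 < y -> x <> y ->
      M x y = finv (1 / (y - x) * RInt f x y).

Definition homogeneous (M : R -> R -> R) : Prop :=
  forall lambda x y : R, 0 < lambda -> 0 < x -> 0 < y ->
    M (lambda * x) (lambda * y) = lambda * M x y.

Definition stolarsky (p x y : R) : R :=
  if Req_EM_T x y then x
  else if Req_EM_T p 0 then (x - y) / (ln x - ln y)
  else if Req_EM_T p 1 then
    exp (- 1) * Rpower (Rpower x x / Rpower y y) (1 / (x - y))
  else
    Rpower ((Rpower x p - Rpower y p) / (p * (x - y))) (1 / (p - 1)).

(* Main.v *)
Require Import Defs.
From Stdlib Require Import Reals Lra.
From Coquelicot Require Import Coquelicot.
Open Scope R_scope.

(** Why the theorem is true.  Let [f] generate the homogeneous mean [M], let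
    [m t = M 1 t] and let [F] be a primitive of [f].  The mean equation at
    [(x, x t)], combined with [M x (x t) = x (m t)], reads
    [f (x m(t)) (t - 1) = (F (x t) - F x) / x].  Differentiating it three times
    in [t] at [t = 1] kills the factor [t - 1] and leaves
    [3 (x^2 f''(x) m'(1)^2 + x f'(x) m''(1)) = x^2 f''(x)].  Symmetry and
    homogeneity give [m t = t m(1/t)], whence [m'(1) = 1/2], so that
    [x f''(x) = k f'(x)] with the constant [k = 12 m''(1)] independent of [x]
    ([generator_ode]).  No division by [f'] takes place, so zeros of [f'],
    which strict monotonicity alone does not exclude, are harmless.

    The equation integrates to [f'(t) = C t^k] ([euler_ode_solution]), with
    [C <> 0] since [f] is not constant.  The mean equation is insensitive to
    replacing [f] by [a f + b] with [a <> 0] ([mean_equation_normalized]), so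
    [M] is the mean of [ln t], [-1/t] or [t^(p-1) / (p-1)] for [p = k + 2], and
    solving for [M] gives [stolarsky p] ([power_slope_stolarsky]).

    Conversely the quotient defining [stolarsky p] is homogeneous of degree
    [p - 1], and positive by the mean value theorem, so that real powers may be
    distributed over it ([stolarsky_homogeneous]). *)

(** * Calculus on the positive half-line *)

Lemma locally_pos (x : R) (P : R -> Prop) :
  0 < x -> (forall t, 0 < t -> P t) -> locally x P.
Proof.
intros Hx HP.
apply (filter_imp (fun t => 0 < t)); [exact HP|].
now apply (open_gt 0).
Qed.

Lemma is_derive_ext_pos (a b : R -> R) (x l : R) :
  0 < x -> (forall t, 0 < t -> a t = b t) -> is_derive a x l -> is_derive b x l.
Proof.
intros Hx E. apply is_derive_ext_loc.
now apply (locally_pos x (fun t => a t = b t)).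
Qed.

Lemma is_derive_pos_unique (a b : R -> R) (x la lb : R) :
  0 < x -> (forall t, 0 < t -> a t = b t) ->
  is_derive a x la -> is_derive b x lb -> la = lb.
Proof.
intros Hx E Ha Hb.
apply (is_derive_ext_pos a b x la Hx E) in Ha.
rewrite <- (is_derive_unique _ _ _ Ha). now apply is_derive_unique.
Qed.

Lemma is_derive_continuity_pt (f : R -> R) (x l : R) :
  is_derive f x l -> continuity_pt f x.
Proof.
intros H. apply continuity_pt_filterlim.
apply (@ex_derive_continuous R_AbsRing R_NormedModule). now exists l.
Qed.

Lemma Rmin_pos (x y : R) : 0 < x -> 0 < y -> 0 < Rmin x y.
Proof. intros; now apply Rmin_glb_lt. Qed.

Lemma mean_value_pos (f f1 : R -> R) (x y : R) :
  (forall t, 0 < t -> is_derive f t (f1 t)) -> 0 < x -> 0 < y ->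
  exists c, 0 < c /\ f y - f x = f1 c * (y - x).
Proof.
intros Hf Hx Hy.
assert (Hm := Rmin_pos x y Hx Hy).
destruct (MVT_gen f x y f1) as [c [Hc E]].
- intros t Ht; apply Hf; lra.
- intros t Ht; apply (is_derive_continuity_pt f t (f1 t)), Hf; lra.
- exists c; split; [lra | exact E].
Qed.

Lemma same_derivative_pos (f g h : R -> R) :
  (forall t, 0 < t -> is_derive f t (h t)) ->
  (forall t, 0 < t -> is_derive g t (h t)) ->
  exists d, forall t, 0 < t -> f t = g t + d.
Proof.
intros Hf Hg. exists (f 1 - g 1). intros t Ht.
destruct (mean_value_pos (fun s => f s - g s) (fun s => h s - h s) 1 t)
  as [c [_ E]]; [|lra|lra|].
- intros s Hs. apply (is_derive_minus f g s (h s) (h s)); auto.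
- simpl in E. lra.
Qed.

Lemma primitive_pos (f : R -> R) :
  (forall t, 0 < t -> continuous f t) ->
  exists F, (forall t, 0 < t -> is_derive F t (f t)) /\
    forall x y, 0 < x -> 0 < y -> RInt f x y = F y - F x.
Proof.
intros Hf.
assert (HI : forall x y, 0 < x -> 0 < y -> ex_RInt f x y).
{ intros x y Hx Hy. apply (@ex_RInt_continuous R_CompleteNormedModule).
  intros z Hz. apply Hf. assert (Hm := Rmin_pos x y Hx Hy). lra. }
exists (fun t => RInt f 1 t). split.
- intros t Ht. apply (is_derive_RInt f _ 1); [|now apply Hf].
  apply (locally_pos t (fun s => is_RInt f 1 s (RInt f 1 s)) Ht).
  intros s Hs. apply (@RInt_correct R_CompleteNormedModule). apply HI; lra.
- intros x y Hx Hy.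
  assert (E : RInt f 1 x + RInt f x y = RInt f 1 y).
  { apply (@RInt_Chasles R_CompleteNormedModule); apply HI; lra. }
  lra.
Qed.

Lemma is_derive_Rpower (a t : R) :
  0 < t -> is_derive (fun s => Rpower s a) t (a * Rpower t (a - 1)).
Proof.
intros Ht. apply is_derive_Reals.
now apply derivable_pt_lim_power.
Qed.

(** The integrating factor [t^(-k)] turns [t f'' = k f'] into the vanishing of
    the derivative of [t^(-k) f'(t)]. *)
Lemma euler_ode_solution (f1 f2 : R -> R) (k : R) :
  (forall t, 0 < t -> is_derive f1 t (f2 t)) ->
  (forall t, 0 < t -> t * f2 t = k * f1 t) ->
  forall t, 0 < t -> f1 t = f1 1 * Rpower t k.
Proof.
intros H1 H2 t Ht.
destruct (same_derivative_pos (fun s => f1 s * Rpower s (- k)) (fun _ => 0)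
           (fun _ => 0)) as [d Hd].
- intros s Hs.
  evar_last.
  { apply (is_derive_mult f1 (fun s => Rpower s (- k)) s (f2 s)
             (- k * Rpower s (- k - 1)));
      [now apply H1 | now apply is_derive_Rpower | exact Rmult_comm]. }
  unfold plus, mult; simpl.
  replace (Rpower s (- k)) with (s * Rpower s (- k - 1)).
  2:{ rewrite <- (Rpower_1 s) at 1 by easy. rewrite <- Rpower_plus.
      f_equal; ring. }
  replace (f2 s * (s * Rpower s (- k - 1)))
    with (s * f2 s * Rpower s (- k - 1)) by ring.
  rewrite (H2 s Hs). ring.
- intros s _. apply (@is_derive_const R_AbsRing R_NormedModule).
- assert (E1 := Hd 1 Rlt_0_1). assert (Et := Hd t Ht). simpl in E1, Et.
  rewrite <- E1 in Et. unfold Rpower at 2 in Et.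
  rewrite ln_1, Rmult_0_r, exp_0, Rmult_1_r in Et.
  rewrite <- Et, Rmult_assoc, <- Rpower_plus, Rplus_opp_l, Rpower_O by easy.
  ring.
Qed.

(** * Homogeneity of the Stolarsky means *)

(** By the mean value theorem the quotient is [c^(p-1)] for some [c > 0]. *)
Lemma power_quotient_pos (p x y : R) :
  p <> 0 -> 0 < x -> 0 < y -> x <> y ->
  0 < (Rpower x p - Rpower y p) / (p * (x - y)).
Proof.
intros Hp Hx Hy Hxy.
destruct (mean_value_pos (fun s => Rpower s p) (fun s => p * Rpower s (p - 1))
            y x) as [c [Hc E]]; auto.
- intros; now apply is_derive_Rpower.
- simpl in E. rewrite E.
  replace (_ / _) with (Rpower c (p - 1)) by (field; lra).
  apply exp_pos.
Qed.

Lemma stolarsky_identric (x y : R) :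
  x <> y ->
  exp (- 1) * Rpower (Rpower x x / Rpower y y) (1 / (x - y))
  = exp ((x * ln x - y * ln y) / (x - y) - 1).
Proof.
intros Hxy. unfold Rpower, Rdiv.
rewrite <- exp_Ropp, <- !exp_plus, ln_exp. f_equal. field. lra.
Qed.

Lemma stolarsky_homogeneous (p : R) : homogeneous (stolarsky p).
Proof.
intros l x y Hl Hx Hy. unfold stolarsky.
destruct (Req_EM_T x y) as [->|Hxy].
{ destruct (Req_EM_T (l * y) (l * y)); [reflexivity | easy]. }
destruct (Req_EM_T (l * x) (l * y)) as [E|Hlxy].
{ exfalso. apply Hxy. apply Rmult_eq_reg_l in E; lra. }
destruct (Req_EM_T p 0) as [Hp|Hp].
{ rewrite !ln_mult by assumption.
  assert (ln x <> ln y) by (intros E; apply Hxy; now apply ln_inv).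
  field; repeat split; lra. }
destruct (Req_EM_T p 1) as [Hp1|Hp1].
{ rewrite !stolarsky_identric by assumption.
  rewrite !ln_mult by assumption.
  transitivity (exp (ln l) * exp ((x * ln x - y * ln y) / (x - y) - 1));
    [|now rewrite exp_ln].
  rewrite <- exp_plus. f_equal. field. repeat split; lra. }
assert (HQ := power_quotient_pos p x y Hp Hx Hy Hxy).
replace ((Rpower (l * x) p - Rpower (l * y) p) / (p * (l * x - l * y)))
  with (Rpower l (p - 1) * ((Rpower x p - Rpower y p) / (p * (x - y)))).
- rewrite <- Rpower_mult_distr by (assumption || apply exp_pos).
  rewrite Rpower_mult.
  replace ((p - 1) * (1 / (p - 1))) with 1 by (field; lra).
  now rewrite Rpower_1.
- rewrite <- !Rpower_mult_distr by assumption.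
  replace (Rpower l p) with (l * Rpower l (p - 1)).
  2:{ rewrite <- (Rpower_1 l) at 1 by easy. rewrite <- Rpower_plus.
      f_equal; ring. }
  field. repeat split; try lra.
Qed.

(** * The mean equation of a generator *)

Lemma smooth_pos_is_derive (f : R -> R) (n : nat) (t : R) :
  smooth_pos f -> 0 < t -> is_derive (Derive_n f n) t (Derive_n f (S n) t).
Proof. intros Hf Ht. apply Derive_correct. exact (Hf (S n) t Ht). Qed.

(** The average of [f] is a value [f c] by the mean value theorem for a
    primitive; hence the prescribed inverse of [f] is applied at a point where
    it is a genuine inverse, and can be cancelled. *)
Lemma generator_mean_equation (M : R -> R -> R) (f finv : R -> R) :
  smooth_pos f -> inverse_pos f finv ->
  (forall x y, 0 < x -> 0 < y -> x <> y ->
     M x y = finv (1 / (y - x) * RInt f x y)) ->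
  exists F, (forall t, 0 < t -> is_derive F t (f t)) /\
    forall x y, 0 < x -> 0 < y -> f (M x y) * (y - x) = F y - F x.
Proof.
intros Hf Hinv HM.
destruct (primitive_pos f) as [F [HF HI]].
{ intros t Ht. apply (@ex_derive_continuous R_AbsRing R_NormedModule).
  exact (Hf 1%nat t Ht). }
exists F; split; [exact HF|].
intros x y Hx Hy.
destruct (Req_dec x y) as [->|Hxy]; [ring|].
destruct (mean_value_pos F f x y HF Hx Hy) as [c [Hc E]].
rewrite (HM x y Hx Hy Hxy), (HI x y Hx Hy), E.
replace (1 / (y - x) * (f c * (y - x))) with (f c) by (field; lra).
now rewrite (Hinv c Hc).
Qed.

(** Leibniz' rule for the third derivative of [(t - 1) u t] at [1], where the
    term containing [u'''] disappears. *)
Lemma third_derivative_at_one (u u1 u2 G g g1 : R -> R) (u3 g2 : R) :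
  (forall t, 0 < t -> is_derive u t (u1 t)) ->
  (forall t, 0 < t -> is_derive u1 t (u2 t)) ->
  is_derive u2 1 u3 ->
  (forall t, 0 < t -> is_derive G t (g t)) ->
  (forall t, 0 < t -> is_derive g t (g1 t)) ->
  is_derive g1 1 g2 ->
  (forall t, 0 < t -> u t * (t - 1) = G t) ->
  3 * u2 1 = g2.
Proof.
intros Hu Hu1 Hu2 HG Hg Hg1 E0.
assert (leibniz : forall (v w : R -> R) (c t dv dw : R),
  is_derive v t dv -> is_derive w t dw ->
  is_derive (fun s => v s * (s - 1) + c * w s) t
    (dv * (t - 1) + (v t + c * dw))).
{ intros v w c t dv dw Hv Hw.
  auto_derive; [repeat split; eexists; eassumption|].
  rewrite (is_derive_unique (fun x : R => v x) t dv Hv).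
  rewrite (is_derive_unique (fun x : R => w x) t dw Hw). ring. }
assert (E1 : forall t, 0 < t -> u1 t * (t - 1) + 1 * u t = g t).
{ intros t Ht.
  apply (is_derive_pos_unique (fun s => u s * (s - 1) + 0 * u s) G t); auto.
  - intros s Hs. rewrite <- (E0 s Hs). ring.
  - replace (u1 t * (t - 1) + 1 * u t)
      with (u1 t * (t - 1) + (u t + 0 * u1 t)) by ring. auto. }
assert (E2 : forall t, 0 < t -> u2 t * (t - 1) + 2 * u1 t = g1 t).
{ intros t Ht.
  apply (is_derive_pos_unique (fun s => u1 s * (s - 1) + 1 * u s) g t); auto.
  replace (u2 t * (t - 1) + 2 * u1 t)
    with (u2 t * (t - 1) + (u1 t + 1 * u1 t)) by ring. auto. }
apply (is_derive_pos_unique (fun s => u2 s * (s - 1) + 2 * u1 s) g1 1);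
  auto with real.
replace (3 * u2 1) with (u3 * (1 - 1) + (u2 1 + 2 * u2 1)) by ring.
auto with real.
Qed.

(** Differentiate [m t = t m(1/t)] at [1].  For a symmetric homogeneous mean
    the section [m t = M 1 t] satisfies this equation. *)
Lemma self_reciprocal_slope (m : R -> R) (m1 : R) :
  (forall t, 0 < t -> m t = t * m (/ t)) ->
  is_derive m 1 m1 -> 2 * m1 = m 1.
Proof.
intros E Hm.
assert (H : m1 = m 1 - m1).
{ apply (is_derive_pos_unique m (fun t => t * m (/ t)) 1); auto with real.
  assert (Hm' : is_derive m (/ 1) m1) by now rewrite Rinv_1.
  auto_derive.
  - repeat split; [now exists m1 | lra].
  - rewrite (is_derive_unique (fun x : R => m x) (/ 1) m1 Hm'). rewrite Rinv_1.
    field. }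
lra.
Qed.

(** Third-order comparison, at [t = 1], of the two sides of the mean equation
    between [x] and [x t].  Only [m] depends on the mean, and it is a function
    of [t] alone, which is why the coefficient [12 m''(1)] is the same for all
    [x]. *)
Lemma generator_ode (f f1 f2 f3 F m m1 m2 : R -> R) (m3 : R) :
  (forall t, 0 < t -> is_derive f t (f1 t)) ->
  (forall t, 0 < t -> is_derive f1 t (f2 t)) ->
  (forall t, 0 < t -> is_derive f2 t (f3 t)) ->
  (forall t, 0 < t -> is_derive F t (f t)) ->
  (forall t, 0 < t -> 0 < m t) ->
  (forall t, 0 < t -> is_derive m t (m1 t)) ->
  (forall t, 0 < t -> is_derive m1 t (m2 t)) ->
  is_derive m2 1 m3 ->
  m 1 = 1 -> m1 1 = / 2 ->
  (forall x t, 0 < x -> 0 < t ->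
     f (x * m t) * (x * t - x) = F (x * t) - F x) ->
  forall x, 0 < x -> x * f2 x = 12 * m2 1 * f1 x.
Proof.
intros Hf Hf1 Hf2 HF Hm Hm0 Hm1 Hm2 m11 m1h E x Hx.
assert (scale : forall (h h' : R -> R) t,
  (forall s, 0 < s -> is_derive h s (h' s)) -> 0 < t ->
  is_derive (fun s => h (x * s)) t (x * h' (x * t))).
{ intros h h' t Hh Ht.
  assert (H := Hh (x * t) (Rmult_lt_0_compat _ _ Hx Ht)).
  auto_derive; [now exists (h' (x * t))|].
  rewrite (is_derive_unique (fun s : R => h s) _ _ H). ring. }
assert (comp : forall (h h' : R -> R) t,
  (forall s, 0 < s -> is_derive h s (h' s)) -> 0 < t ->
  is_derive (fun s => h (x * m s)) t (x * m1 t * h' (x * m t))).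
{ intros h h' t Hh Ht.
  assert (H := Hh (x * m t) (Rmult_lt_0_compat _ _ Hx (Hm t Ht))).
  assert (H' := Hm0 t Ht).
  auto_derive; [split; [now exists (h' (x * m t)) | split; [now exists (m1 t)|easy]]|].
  rewrite (is_derive_unique (fun s : R => h s) _ _ H).
  rewrite (is_derive_unique (fun s : R => m s) _ _ H'). ring. }
assert (T : 3 * (x * m2 1 * f1 (x * m 1)
                 + x * m1 1 * (x * m1 1 * f2 (x * m 1)))
            = x * (x * f2 (x * 1))).
{ apply (third_derivative_at_one
    (fun t => f (x * m t))
    (fun t => x * m1 t * f1 (x * m t))
    (fun t => x * m2 t * f1 (x * m t) + x * m1 t * (x * m1 t * f2 (x * m t)))
    (fun t => (F (x * t) - F x) / x)
    (fun t => f (x * t)) (fun t => x * f1 (x * t))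
    (Derive (fun t => x * m2 t * f1 (x * m t)
                      + x * m1 t * (x * m1 t * f2 (x * m t))) 1)).
  - intros t Ht. now apply comp.
  - intros t Ht.
    assert (H := comp f1 f2 t Hf1 Ht). assert (H' := Hm1 t Ht).
    apply (is_derive_mult (fun t => x * m1 t) (fun t => f1 (x * m t)) t
             (x * m2 t) (x * m1 t * f2 (x * m t))); auto.
    + apply (is_derive_scal m1 t x (m2 t)). exact H'.
    + exact Rmult_comm.
  - apply Derive_correct.
    assert (H1 := comp f1 f2 1 Hf1 Rlt_0_1).
    assert (H2 := comp f2 f3 1 Hf2 Rlt_0_1).
    assert (H3 := Hm1 1 Rlt_0_1).
    assert (D1 : ex_derive (fun t => f1 (x * m t)) 1) by (eexists; exact H1).
    assert (D2 : ex_derive (fun t => f2 (x * m t)) 1) by (eexists; exact H2).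
    assert (D3 : ex_derive (fun t => x * m1 t) 1).
    { apply (ex_derive_scal m1 x 1). eexists; exact H3. }
    assert (D4 : ex_derive (fun t => x * m2 t) 1).
    { apply (ex_derive_scal m2 x 1). eexists; exact Hm2. }
    apply (ex_derive_plus (fun t => x * m2 t * f1 (x * m t))
             (fun t => x * m1 t * (x * m1 t * f2 (x * m t)))).
    + now apply (ex_derive_mult (fun t => x * m2 t) (fun t => f1 (x * m t))).
    + apply (ex_derive_mult (fun t => x * m1 t)
               (fun t => x * m1 t * f2 (x * m t))); [easy|].
      now apply (ex_derive_mult (fun t => x * m1 t) (fun t => f2 (x * m t))).
  - intros t Ht.
    assert (H := HF (x * t) (Rmult_lt_0_compat _ _ Hx Ht)).
    auto_derive; [eexists; exact H|].
    rewrite (is_derive_unique (fun s : R => F s) _ _ H). field. lra.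
  - intros t Ht. now apply scale.
  - assert (H := scale f1 f2 1 Hf1 Rlt_0_1).
    apply (is_derive_scal (fun t => f1 (x * t)) 1 x). exact H.
  - intros t Ht. rewrite <- (E x t Hx Ht). field. lra. }
rewrite m11, m1h, Rmult_1_r in T.
apply (Rmult_eq_reg_l (x / 4)); [|lra].
lra.
Qed.

(** * Means generated by functions with power slope *)

(** Functions with proportional derivatives on the half-line differ by an
    affine change [f = c phi + d], and such a change preserves the mean
    equation; the mean can thus be computed with the simplest generator. *)
Lemma mean_equation_normalized (f F w phi Phi : R -> R) (c : R) :
  c <> 0 ->
  (forall t, 0 < t -> is_derive F t (f t)) ->
  (forall t, 0 < t -> is_derive f t (c * w t)) ->
  (forall t, 0 < t -> is_derive Phi t (phi t)) ->
  (forall t, 0 < t -> is_derive phi t (w t)) ->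
  forall x y z, 0 < x -> 0 < y -> 0 < z -> x <> y ->
  f z * (y - x) = F y - F x -> phi z = (Phi y - Phi x) / (y - x).
Proof.
intros Hc HF Hf HPhi Hphi x y z Hx Hy Hz Hxy E.
destruct (same_derivative_pos f (fun t => c * phi t) (fun t => c * w t))
  as [d Hd]; auto.
{ intros t Ht. apply (is_derive_scal phi t c). auto. }
destruct (same_derivative_pos F (fun t => c * Phi t + d * t) f)
  as [e He]; auto.
{ intros t Ht. assert (H := HPhi t Ht).
  auto_derive; [eexists; exact H|].
  rewrite (is_derive_unique (fun t : R => Phi t) _ _ H), (Hd t Ht). ring. }
rewrite (Hd z Hz), (He x Hx), (He y Hy) in E.
apply (Rmult_eq_reg_l (c * (y - x))).
- field_simplify; lra.
- apply Rmult_integral_contrapositive; split; lra.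
Qed.

Lemma power_slope_stolarsky (f F : R -> R) (c p : R) :
  c <> 0 ->
  (forall t, 0 < t -> is_derive F t (f t)) ->
  (forall t, 0 < t -> is_derive f t (c * Rpower t (p - 2))) ->
  forall x y z, 0 < x -> 0 < y -> 0 < z -> x <> y ->
  f z * (y - x) = F y - F x -> z = stolarsky p x y.
Proof.
intros Hc HF Hf x y z Hx Hy Hz Hxy E.
assert (N := fun phi Phi H1 H2 =>
  mean_equation_normalized f F (fun t => Rpower t (p - 2)) phi Phi c
    Hc HF Hf H1 H2 x y z Hx Hy Hz Hxy E).
unfold stolarsky.
destruct (Req_EM_T x y) as [|_]; [contradiction|].
destruct (Req_EM_T p 0) as [Hp|Hp].
{ assert (Hln : ln x <> ln y) by (intros H; apply Hxy; now apply ln_inv).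
  assert (K : - / z = (- ln y - - ln x) / (y - x)).
  { apply (N (fun t => - / t) (fun t => - ln t)).
    - intros t Ht. auto_derive; [lra|ring].
    - intros t Ht. auto_derive; [lra|].
      rewrite Hp. replace (0 - 2) with (- (2)) by ring.
      rewrite Rpower_Ropp. replace 2 with (INR 2) by (simpl; ring).
      rewrite Rpower_pow by assumption. field. lra. }
  rewrite <- (Rinv_inv z).
  replace (/ z) with ((ln x - ln y) / (x - y)).
  - field. repeat split; lra.
  - replace (/ z) with (- - / z) by ring. rewrite K. field. repeat split; lra. }
destruct (Req_EM_T p 1) as [Hp1|Hp1].
{ rewrite stolarsky_identric by assumption.
  assert (K : ln z = ((y * ln y - y) - (x * ln x - x)) / (y - x)).
  { apply (N ln (fun t => t * ln t - t)).
    - intros t Ht. auto_derive; [lra|field; lra].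
    - intros t Ht. auto_derive; [lra|].
      rewrite Hp1. replace (1 - 2) with (- (1)) by ring.
      rewrite Rpower_Ropp, Rpower_1 by assumption. field. lra. }
  rewrite <- (exp_ln z) by assumption. f_equal. rewrite K. field. repeat split; lra. }
assert (K : Rpower z (p - 1) / (p - 1)
            = (Rpower y p / (p * (p - 1)) - Rpower x p / (p * (p - 1)))
              / (y - x)).
{ apply (N (fun t => Rpower t (p - 1) / (p - 1))
           (fun t => Rpower t p / (p * (p - 1)))).
  - intros t Ht. assert (H := is_derive_Rpower p t Ht).
    auto_derive; [eexists; exact H|].
    rewrite (is_derive_unique (fun s : R => Rpower s p) _ _ H). field. lra.
  - intros t Ht. assert (H := is_derive_Rpower (p - 1) t Ht).
    auto_derive; [eexists; exact H|].
    rewrite (is_derive_unique (fun s : R => Rpower s (p - 1)) _ _ H).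
    replace (p - 1 - 1) with (p - 2) by ring. field. lra. }
replace ((Rpower x p - Rpower y p) / (p * (x - y))) with (Rpower z (p - 1)).
- rewrite Rpower_mult.
  replace ((p - 1) * (1 / (p - 1))) with 1 by (field; lra).
  now rewrite Rpower_1.
- replace (Rpower z (p - 1)) with ((p - 1) * (Rpower z (p - 1) / (p - 1)))
    by (field; lra).
  rewrite K. field. repeat split; lra.
Qed.

(** * The characterization *)

Lemma mean_section_is_derive (M : R -> R -> R) (n : nat) (t : R) :
  smooth_pos2 M -> 0 < t ->
  is_derive (Derive_n (M 1) n) t (Derive_n (M 1) (S n) t).
Proof.
intros HM Ht. apply Derive_correct.
(* Among the iterated partial derivatives, follow the branch where every
   derivative is taken in the second variable: that variable alone moves along
   the section [M 1]. *)
assert (gen : forall n (N : R -> R -> R), ex_diff_n N (S n) 1 t ->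
  ex_derive (Derive_n (N 1) n) t).
{ clear. induction n as [|n IH]; intros N H.
  - exact (proj1 (proj2 (proj2 H))).
  - specialize (IH _ (proj2 (proj2 (proj2 (proj2 H))))).
    apply (ex_derive_ext (Derive_n (fun v => Derive (fun z => N 1 z) v) n));
      [|exact IH].
    intros s. rewrite <- Nat.add_1_r. exact (Derive_n_comp (N 1) n 1 s). }
apply gen. apply HM; lra.
Qed.

Theorem theorem3p26 (M : R -> R -> R) (hM : integral_mean_first_kind M) :
  homogeneous M <->
  exists p : R, forall x y : R, 0 < x -> 0 < y -> M x y = stolarsky p x y.
Proof.
split.
2:{ intros [p Hp] l x y Hl Hx Hy.
    rewrite !Hp by (try apply Rmult_lt_0_compat; assumption).
    now apply stolarsky_homogeneous. }
intros Hhom.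
destruct hM as [[Mpos Msmooth Mbounds Msym]
                [f [finv [Hf [Hmono [Hinv HM]]]]]].
destruct (generator_mean_equation M f finv Hf Hinv HM) as [F [HF E]].
assert (Mdiag : forall x, 0 < x -> M x x = x).
{ intros x Hx. assert (H := Mbounds x x Hx Hx).
  rewrite Rmin_left, Rmax_left in H; lra. }
assert (Df := fun n t => smooth_pos_is_derive f n t Hf).
assert (Dm := fun n t => mean_section_is_derive M n t Msmooth).
assert (m1h : Derive_n (M 1) 1 1 = / 2).
{ assert (H : 2 * Derive_n (M 1) 1 1 = M 1 1).
  { apply (self_reciprocal_slope (M 1)).
    - intros t Ht. assert (0 < / t) by now apply Rinv_0_lt_compat.
      rewrite <- Hhom by lra. rewrite Rmult_1_r, Rinv_r by lra.
      apply Msym; lra.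
    - apply (Dm 0%nat); lra. }
  rewrite Mdiag in H; lra. }
set (k := 12 * Derive_n (M 1) 2 1).
assert (ode : forall x, 0 < x -> x * Derive_n f 2 x = k * Derive_n f 1 x).
{ apply (generator_ode f (Derive_n f 1) (Derive_n f 2) (Derive_n f 3) F
           (M 1) (Derive_n (M 1) 1) (Derive_n (M 1) 2) (Derive_n (M 1) 3 1)).
  - exact (Df 0%nat).
  - exact (Df 1%nat).
  - exact (Df 2%nat).
  - exact HF.
  - intros t Ht. apply Mpos; lra.
  - exact (Dm 0%nat).
  - exact (Dm 1%nat).
  - apply (Dm 2%nat); lra.
  - apply Mdiag; lra.
  - exact m1h.
  - intros x t Hx Ht. rewrite <- Hhom by lra. rewrite Rmult_1_r.
    apply E; [lra | now apply Rmult_lt_0_compat]. }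
assert (slope := euler_ode_solution (Derive_n f 1) (Derive_n f 2) k
                   (Df 1%nat) ode).
set (c := Derive_n f 1 1) in slope.
assert (Hc : c <> 0).
{ intros Hc0.
  destruct (mean_value_pos f (Derive_n f 1) 1 2 (Df 0%nat)) as [s [Hs Es]];
    [lra|lra|].
  rewrite (slope s Hs), Hc0 in Es.
  destruct Hmono as [H|H]; specialize (H 1 2); lra. }
exists (k + 2). intros x y Hx Hy.
destruct (Req_dec x y) as [->|Hxy].
{ unfold stolarsky. rewrite Mdiag by assumption.
  destruct (Req_EM_T y y); [reflexivity | easy]. }
apply (power_slope_stolarsky f F c); auto.
intros t Ht. replace (k + 2 - 2) with k by ring.
rewrite <- slope by assumption. now apply (Df 0%nat).
Qed.
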